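(* Let $\Omega\subset\mathbb R^d$ be convex and compact and of dimension at least two. Then $\mathsf{HK}$ is not $K$-semiconcave on $\mathcal M(\Omega)$ for any $K\in\mathbb R$; that is, for every $K\in\mathbb R$ there exist $\mu_0,\mu_1,\mu_*\in\mathcal M(\Omega)$, a geodesic curve $\mu:[0,1]\to\mathcal M(\Omega)$ in $(\mathcal M(\Omega),\mathsf{HK})$ with $\mu(0)=\mu_0$, $\mu(1)=\mu_1$, and $s\in[0,1]$ such that $$\mathsf{HK}(\mu(s),\mu_* )^2<(1-s)\mathsf{HK}(\mu_0,\mu_* )^2+s\,\mathsf{HK}(\mu_1,\mu_* )^2-Ks(1-s)\mathsf{HK}(\mu_0,\mu_1)^2.$$
   Context: The dimension of $\Omega$ means the dimension of its affine hull. $\mathcal M(\Omega)$ is the set of finite nonnegative Borel measures on $\Omega$. The cone over $\Omega$ is $\mathfrak C_\Omega:=(\Omega\times[0,\infty[)/(\Omega\times\{0\})$, with points $[x,r]$, and metric $\mathsf d_{\mathfrak C}([x_0,r_0],[x_1,r_1])^2=r_0^2+r_1^2-2r_0r_1\cos_\pi(|x_0-x_1|)$, $\cos_\pi(L)=\cos(\min\{L,\pi\})$. $\mathcal M_2(\mathfrak C_\Omega)$ is the set of finite nonnegative Borel measures with $\int r^2\mathrm d\lambda<\infty$. $\mathsf W_{\mathfrak C}(\lambda_0,\lambda_1)^2=\inf\iint\mathsf d_{\mathfrak C}^2\,\mathrm d\gamma$ over nonnegative measures $\gamma$ on $\mathfrak C_\Omega\times\mathfrak C_\Omega$ with marginals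 $\lambda_0,\lambda_1$ ($=\infty$ if the masses differ). The projection $\mathfrak P:\mathcal M_2(\mathfrak C_\Omega)\to\mathcal M(\Omega)$ is given by $\int_\Omega\phi\,\mathrm d\mathfrak P\lambda=\int r^2\phi(x)\,\mathrm d\lambda([x,r])$, $\phi\in\mathrm C^0(\Omega)$. The Hellinger–Kantorovich distance is $\mathsf{HK}(\mu_0,\mu_1)=\min\{\mathsf W_{\mathfrak C}(\lambda_0,\lambda_1)\mid\mathfrak P\lambda_j=\mu_j\}$. A geodesic curve is a curve with $\mathsf{HK}(\mu(s),\mu(t))=|s-t|\,\mathsf{HK}(\mu(0),\mu(1))$ for all $s,t\in[0,1]$. *)

(* Defs.v *)
From HB Require Import structures.
From mathcomp Require Import all_boot all_order all_algebra.
From mathcomp Require Import all_classical all_reals all_analysis.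

Set Implicit Arguments.
Unset Strict Implicit.
Unset Printing Implicit Defensive.
Import Order.TTheory GRing.Theory Num.Theory.
Import numFieldNormedType.Exports.

Local Open Scope classical_set_scope.
Local Open Scope ring_scope.
Local Open Scope quotient_scope.

Section AffineDimension.
Context {R : realType} {d : nat}.
Implicit Type A : set 'rV[R]_d.

Definition affine_hull A : set 'rV[R]_d :=
  [set y | exists n (x : 'I_n -> 'rV[R]_d) (c : 'I_n -> R),
    [/\ forall i, A (x i), \sum_(i < n) c i = 1
      & y = \sum_(i < n) c i *: x i]].

(* The affine hull of A is the translate x + U of a linear subspace U with
   dim U = n; in particular A is nonempty. *)
Definition has_dimension A (n : nat) : Prop :=
  exists (x : 'rV[R]_d) (U : {vspace 'rV[R]_d}),
    affine_hull A = [set x + u | u in [set u | u \in U]] /\ \dim U = n.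

Lemma has_dimension_nonempty A n : has_dimension A n -> A !=set0.
Proof.
move=> [x [U [hA _]]].
have : affine_hull A x by rewrite hA; exists 0 => /=; rewrite ?mem0v ?addr0.
move=> [[|m] [y [c [yA + _]]]]; last by exists (y ord0); exact: yA.
by rewrite big_ord0 => /eqP; rewrite eq_sym oner_eq0.
Qed.

(* The norm that the library puts on row vectors is the sup norm. *)
Definition euclid_dist (x y : 'rV[R]_d) : R :=
  Num.sqrt (\sum_(i < d) (x ord0 i - y ord0 i) ^+ 2).

End AffineDimension.

(* Omega as a topological space of its own.  Measurable types of the library
   are pointed, hence the proof of nonemptiness in the type. *)
Definition base_space (R : realType) (d : nat) (Omega : set 'rV[R]_d)
  (ne : Omega !=set0) : Type := set_type Omega.

Section BaseSpace.
Context {R : realType} {d : nat} (Omega : set 'rV[R]_d) (ne : Omega !=set0).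

HB.instance Definition _ := Topological.copy (base_space ne) (set_type Omega).
HB.instance Definition _ :=
  isPointed.Build (base_space ne) (exist _ (projT1 (cid ne)) (mem_set (projT2 (cid ne)))).

End BaseSpace.

Section Cone.
Context {R : realType} {d : nat} (Omega : set 'rV[R]_d) (ne : Omega !=set0).

Local Notation X := (base_space ne * {nonneg R})%type.

Definition cone_rel (p q : X) : bool :=
  (p == q) || (p.2%:num == 0) && (q.2%:num == 0).

Lemma cone_rel_refl : reflexive cone_rel.
Proof. by move=> p; rewrite /cone_rel eqxx. Qed.

Lemma cone_rel_sym : symmetric cone_rel.
Proof. by move=> p q; rewrite /cone_rel eq_sym andbC. Qed.

Lemma cone_rel_trans : transitive cone_rel.
Proof.
move=> q p r /orP[/eqP-> //|/andP[p0 q0]] /orP[/eqP<-|/andP[_ r0]].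
  by rewrite /cone_rel p0 q0 orbT.
by rewrite /cone_rel p0 r0 orbT.
Qed.

Canonical cone_equiv :=
  EquivRel cone_rel cone_rel_refl cone_rel_sym cone_rel_trans.

Definition cone : Type := {eq_quot cone_equiv}.

HB.instance Definition _ := Choice.copy cone {eq_quot cone_equiv}.
HB.instance Definition _ := Quotient.copy cone {eq_quot cone_equiv}.
HB.instance Definition _ := isPointed.Build cone (\pi_cone (point, 0%:nng)).

Definition cone_pt (x : base_space ne) (r : {nonneg R}) : cone := \pi_cone (x, r).

(* [cone_base p] is meaningful only if [cone_radius p != 0]; at the vertex it is an
   arbitrary point of Omega, always multiplied by a zero radius below. *)
Definition cone_base (p : cone) : base_space ne := (repr p).1.
Definition cone_radius (p : cone) : R := (repr p).2%:num.

Definition cone_dist (p q : cone) : R :=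
  Num.sqrt (cone_radius p ^+ 2 + cone_radius q ^+ 2
    - 2 * cone_radius p * cone_radius q
      * cos (Num.min (euclid_dist (\val (cone_base p)) (\val (cone_base q))) pi)).

Lemma cone_radiusE x r : cone_radius (cone_pt x r) = r%:num.
Proof.
rewrite /cone_radius /cone_pt; case: piP => q /eqmodP/=.
by rewrite /cone_rel => /orP[/eqP<- //|/andP[/= /eqP-> /eqP->]].
Qed.

Lemma cone_baseE x r : r%:num != 0 -> cone_base (cone_pt x r) = x.
Proof.
move=> r0; rewrite /cone_base /cone_pt; case: piP => q /eqmodP/=.
by rewrite /cone_rel => /orP[/eqP<- //|/andP[/= r1]]; rewrite r1 in r0.
Qed.

Lemma cone_distE x0 r0 x1 r1 :
  cone_dist (cone_pt x0 r0) (cone_pt x1 r1) =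
  Num.sqrt (r0%:num ^+ 2 + r1%:num ^+ 2
    - 2 * r0%:num * r1%:num
      * cos (Num.min (euclid_dist (\val x0) (\val x1)) pi)).
Proof.
rewrite /cone_dist !cone_radiusE.
have [->|r00] := eqVneq r0%:num 0; first by rewrite !(mulr0, mul0r).
have [->|r10] := eqVneq r1%:num 0; first by rewrite !(mulr0, mul0r).
by rewrite !cone_baseE.
Qed.

Definition cone_open (U : set cone) : Prop :=
  forall p, U p -> exists2 e : R, 0 < e & forall q, cone_dist p q < e -> U q.

End Cone.

Section HellingerKantorovich.
Context {R : realType} {d : nat} (Omega : set 'rV[R]_d) (ne : Omega !=set0).

Definition borel_base := g_sigma_algebraType (@open (base_space ne)).
Definition borel_cone := g_sigma_algebraType (@cone_open R d Omega ne).


Definition measures := {finite_measure set borel_base -> \bar R}.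
Definition cone_measures := {finite_measure set borel_cone -> \bar R}.

Local Open Scope ereal_scope.

Definition finite_second_moment (lam : cone_measures) : Prop :=
  \int[lam]_p (cone_radius p ^+ 2)%:E < +oo.

(* The metric space [cone] is separable, so that the product sigma-algebra is
   the Borel sigma-algebra of the product. *)
Definition coupling (lam0 lam1 : cone_measures)
    (gam : {measure set (borel_cone * borel_cone)%type -> \bar R}) : Prop :=
  forall A : set borel_cone, measurable A ->
    gam (A `*` setT) = lam0 A /\ gam (setT `*` A) = lam1 A.

(* The infimum of the empty set is +oo, which covers different masses. *)
Definition cone_wasserstein (lam0 lam1 : cone_measures) : \bar R :=
  sqrte (ereal_inf
    [set c | exists2 gam, coupling lam0 lam1 gam
      & c = \int[gam]_z (cone_dist z.1 z.2 ^+ 2)%:E]).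

(* mu = P lam: finite Borel measures on the compact Omega are determined by
   their integrals of continuous functions. *)
Definition projects_to (lam : cone_measures) (mu : measures) : Prop :=
  forall phi : base_space ne -> R, continuous phi ->
    \int[mu]_x (phi x)%:E = \int[lam]_p (cone_radius p ^+ 2 * phi (cone_base p))%:E.

Definition HK (mu0 mu1 : measures) : \bar R :=
  ereal_inf
    [set w | exists lam0 lam1 : cone_measures,
      [/\ finite_second_moment lam0, finite_second_moment lam1,
          projects_to lam0 mu0, projects_to lam1 mu1
        & w = cone_wasserstein lam0 lam1]].

(* A curve on [0, 1] is a function on R whose values off [0, 1] are ignored. *)
Definition HK_geodesic (mu : R -> measures) : Prop :=
  forall s t : R, (0 <= s <= 1)%R -> (0 <= t <= 1)%R ->
    HK (mu s) (mu t) = `|s - t|%:E * HK (mu 0%R) (mu 1%R).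

End HellingerKantorovich.

(* Main.v *)
Require Import Defs.
From mathcomp Require Import all_boot all_order all_algebra.
From mathcomp Require Import all_classical all_reals all_analysis.
Import Order.TTheory GRing.Theory Num.Theory.
Import numFieldNormedType.Exports.
Local Open Scope classical_set_scope.
Local Open Scope ring_scope.
From mathcomp Require Import measurable_realfun ring lra.

(* The cone over a flat base of dimension at least two is negatively curved near its
   vertex, and on Dirac masses at distance at most pi/2 HK is the cone distance:
   HK(a^2 delta_x, b^2 delta_y)^2 = a^2 + b^2 - 2ab cos|x - y|.  In orthonormal
   coordinates on a planar piece of Omega, let mu be the geodesic between the Diracs
   at (-3t, 0) and (3t, 0); its midpoint is cos(3t)^2 delta_0.  Against
   nu = M^2 delta_(0, 4t), the part of
   (HK(mu_0, nu)^2 + HK(mu_1, nu)^2) / 2 - HK(mu_(1/2), nu)^2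
   that is linear in M is 2M (cos 3t cos 4t - cos 5t), which is positive because the
   planar hypotenuse 5t is longer than the spherical one.  Letting M grow defeats
   every K. *)

Set Implicit Arguments.
Unset Strict Implicit.
Unset Printing Implicit Defensive.

(** * Borel measurability on the cone *)

Section ConeTopology.
Context {R : realType} {d : nat} {Omega : set 'rV[R]_d} {ne : Omega !=set0}.
Implicit Types (p q : cone ne) (x y : base_space ne).

Lemma cone_radius_ge0 p : 0 <= cone_radius p.
Proof. by rewrite /cone_radius. Qed.

(** The gap is [2 * a * b * (1 - c)]. Besides making the radicand of [cone_dist] nonnegative, this
    serves in [coupling_cost_ge] for a [c] that is only an upper bound of a cosine. *)
Lemma cone_cos_law_ge (a b c : R) : 0 <= a -> 0 <= b -> c <= 1 ->
  (a - b) ^+ 2 <= a ^+ 2 + b ^+ 2 - 2 * a * b * c.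
Proof.
move=> a0 b0 c1; have : 0 <= a * b * (1 - c) by rewrite !mulr_ge0 ?subr_ge0.
by lra.
Qed.

Lemma sqr_cone_dist p q : cone_dist p q ^+ 2 =
  cone_radius p ^+ 2 + cone_radius q ^+ 2 - 2 * cone_radius p * cone_radius q
    * cos (Num.min (euclid_dist (\val (cone_base p)) (\val (cone_base q))) pi).
Proof.
rewrite sqr_sqrtr// (le_trans _ (cone_cos_law_ge _ _ (cos_le1 _))) ?sqr_ge0//;
  exact: cone_radius_ge0.
Qed.

Lemma cone_radius_lipschitz p q : `|cone_radius p - cone_radius q| <= cone_dist p q.
Proof.
by rewrite -sqrtr_sqr ler_wsqrtr// cone_cos_law_ge ?cone_radius_ge0 ?cos_le1.
Qed.

Lemma ler_coord_euclid_dist (u v : 'rV[R]_d) i :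
  `|u ord0 i - v ord0 i| <= euclid_dist u v.
Proof.
rewrite -sqrtr_sqr ler_wsqrtr// (bigD1 i)//= lerDl sumr_ge0// => j _.
exact: sqr_ge0.
Qed.

Lemma euclid_dist_ge0 (u v : 'rV[R]_d) : 0 <= euclid_dist u v.
Proof. exact: sqrtr_ge0. Qed.

(** The topology comes from the sup norm, which [ler_coord_euclid_dist] bounds by the Euclidean
    distance. *)
Lemma open_base_euclid (V : set (base_space ne)) x : open V -> V x ->
  exists2 e : R, 0 < e & forall y, euclid_dist (\val x) (\val y) < e -> V y.
Proof.
move=> [U oU <-] /= Ux.
have [e e0 eU] : exists2 e : R, 0 < e & ball (set_val x) e `<=` U.
  by have /nbhs_ballP[e e0 eU] := open_nbhs_nbhs (conj oU Ux); exists e.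
exists e => // y xy; apply: eU; split=> // i j.
rewrite (ord1 i); exact: le_lt_trans (ler_coord_euclid_dist _ _ _) xy.
Qed.

(** A small cone ball around [p] misses the vertex and stays in the sector of angle less than [e1]
    around the ray through [p]. *)
Lemma cone_open_base (V : set (base_space ne)) : open V ->
  cone_open [set p | cone_radius p != 0 /\ V (cone_base p)].
Proof.
move=> oV p [/= rp0 Vp].
have rp : 0 < cone_radius p by rewrite lt_def rp0 cone_radius_ge0.
have [e e0 eV] := open_base_euclid oV Vp.
pose e1 := Num.min e pi; have e1_gt0 : 0 < e1 by rewrite lt_min e0 pi_gt0.
have e1pi : e1 <= pi by rewrite ge_min lexx orbT.
have ce1 : cos e1 < 1.
  by rewrite -cos0 ltr_cos// in_itv/= ?lexx ?pi_ge0 ?(ltW e1_gt0).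
(* Clipping at 0 keeps [c ^+ 2 < 1] even when [e1 = pi], and allows [key] at [c' = 0], the case that
   excludes the vertex. *)
pose c := Num.max 0 (cos e1).
have c0 : 0 <= c by rewrite le_max lexx.
have c1 : c < 1 by rewrite gt_max ltr01.
have c21 : 0 < 1 - c ^+ 2 by rewrite subr_gt0 expr_lt1.
(* e2 is the distance from p to the rays at angle arccos c from its own *)
pose e2 := cone_radius p * Num.sqrt (1 - c ^+ 2).
have e20 : 0 < e2 by rewrite mulr_gt0// sqrtr_gt0.
have e2E : e2 ^+ 2 = cone_radius p ^+ 2 * (1 - c ^+ 2).
  by rewrite exprMn sqr_sqrtr// ltW.
exists e2 => // q pq.
have : cone_dist p q ^+ 2 < e2 ^+ 2.
  by rewrite ltr_pXn2r// nnegrE ?(ltW e20)// sqrtr_ge0.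
rewrite e2E sqr_cone_dist; set C := cos _ => dpq.
(* As a quadratic in the radius of [q], the right side with [c' = c] is minimal at
   [cone_radius p * c], with minimum [e2 ^+ 2]; [h2] completes the square. *)
have key c' : c' <= c -> e2 ^+ 2 <= cone_radius p ^+ 2 + cone_radius q ^+ 2
    - 2 * cone_radius p * cone_radius q * c'.
  move=> c'c; rewrite e2E.
  have h1 : 0 <= cone_radius p * cone_radius q * (c - c').
    by rewrite !mulr_ge0 ?cone_radius_ge0 ?subr_ge0.
  have h2 := sqr_ge0 (cone_radius q - cone_radius p * c).
  by lra.
rewrite -e2E in dpq; split => /=.
  apply/eqP => rq0; have := key 0 c0; rewrite !rq0 in dpq *.
  by rewrite !mulr0 mul0r in dpq *; lra.
apply: eV; rewrite ltNge; apply/negP => ed.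
have /key : C <= c; last by lra.
rewrite le_max; apply/orP; right.
rewrite leNgt ltr_cos ?in_itv/= ?(ltW e1_gt0)//.
  by rewrite -leNgt /e1 le_min2.
by rewrite le_min euclid_dist_ge0 pi_ge0/= ge_min lexx orbT.
Qed.

Lemma cone_open_radius_gt (a : R) : @cone_open R d Omega ne [set p | a < cone_radius p].
Proof.
move=> p /= ap; exists (cone_radius p - a); first by rewrite subr_gt0.
move=> q /(le_lt_trans (cone_radius_lipschitz p q)) pq /=.
by have := ler_norm (cone_radius p - cone_radius q); lra.
Qed.

Lemma measurable_cone_radius :
  measurable_fun setT (fun p : borel_cone ne => cone_radius p).
Proof.
apply: (measurability (@RGenOInfty.G R)); first exact: RGenOInfty.measurableE.
move=> _ [_ [a ->] <-]; rewrite setTI; apply: sub_sigma_algebra => /=.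
rewrite (_ : _ @^-1` _ = [set p | a < cone_radius p]).
  exact: cone_open_radius_gt.
by apply/seteqP; split=> p /=; rewrite in_itv/= andbT.
Qed.

Lemma measurable_continuous_base (phi : base_space ne -> R) :
  continuous phi -> measurable_fun setT (fun x : borel_base ne => phi x).
Proof.
move=> cphi; apply: (measurability (@RGenOpens.G R)).
  exact: RGenOpens.measurableE.
move=> _ [_ [a [b ->]] <-]; rewrite setTI; apply: sub_sigma_algebra => /=.
by move/continuousP : cphi; apply; exact: interval_open.
Qed.

Lemma measurable_cone_radius_neq0 :
  measurable [set p : borel_cone ne | cone_radius p != 0].
Proof.
rewrite (_ : [set _ | _] = [set p | cone_radius p != 0 /\ setT (cone_base p)]).
  by apply: sub_sigma_algebra; apply: cone_open_base; exact: openT.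
by apply/seteqP; split => // p [].
Qed.

(** [cone_base] makes an arbitrary choice at the vertex. The value 0 there removes this choice, and
    a factor [cone_radius p] hides the change. *)
Definition off_vertex (phi : base_space ne -> R) (p : cone ne) : R :=
  if cone_radius p == 0 then 0 else phi (cone_base p).

Lemma measurable_off_vertex (phi : base_space ne -> R) : continuous phi ->
  measurable_fun setT (fun p : borel_cone ne => off_vertex phi p).
Proof.
move=> cphi.
pose D := [set p : borel_cone ne | cone_radius p != 0].
have mf : measurable_fun D (fun p : borel_cone ne => phi (cone_base p)).
  apply: (measurability (@RGenOpens.G R)).
    exact: RGenOpens.measurableE.
  move=> _ [_ [a [b ->]] <-]; apply: sub_sigma_algebra => /=.
  apply: (cone_open_base (V := phi @^-1` `]a, b[%classic)).
  by move/continuousP : cphi; apply; exact: interval_open.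
rewrite (_ : (fun p => _) = (fun p : borel_cone ne => phi (cone_base p)) \_ D).
  by rewrite -(measurable_restrictT
    (fun p : borel_cone ne => phi (cone_base p)) measurable_cone_radius_neq0).
apply/funext => p; rewrite /off_vertex patchE; case: ifPn => [/eqP r0|r0].
  by have nD : ~ D p; [rewrite /D/= r0 eqxx|rewrite memNset].
by rewrite mem_set.
Qed.

Lemma measurable_sqr_radius_base (phi : base_space ne -> R) : continuous phi ->
  measurable_fun setT
    (fun p : borel_cone ne => cone_radius p ^+ 2 * phi (cone_base p)).
Proof.
move=> cphi.
rewrite (_ : (fun p => _) = (fun p => cone_radius p ^+ 2 * off_vertex phi p)).
  apply: measurable_funM; last exact: measurable_off_vertex.
  by apply: measurable_funX; exact: measurable_cone_radius.
apply/funext => p; rewrite /off_vertex; case: ifPn => [/eqP->|//].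
by rewrite expr0n !mul0r.
Qed.

Lemma continuous_base_coord i : continuous (fun x => \val x ord0 i : R).
Proof.
move=> x; apply: (@continuous_comp _ _ _ (fun x : base_space ne => \val x)
    (fun u : 'rV[R]_d => u ord0 i)); last exact: coord_continuous.
exact: initial_continuous.
Qed.

(** The squared distance is a continuous expression in the two radii and finitely many base
    coordinates, each a measurable function of one factor. The coordinates may be cut to 0 at the
    vertex because the product of the radii vanishes there. *)
Lemma measurable_sqr_cone_dist : measurable_fun setT
  (fun z : borel_cone ne * borel_cone ne => cone_dist z.1 z.2 ^+ 2).
Proof.
pose B i := off_vertex (fun x => \val x ord0 i).
have -> : (fun z : borel_cone ne * borel_cone ne => cone_dist z.1 z.2 ^+ 2) =
    (fun z => cone_radius z.1 ^+ 2 + cone_radius z.2 ^+ 2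
    - 2 * cone_radius z.1 * cone_radius z.2
    * cos (Num.min (Num.sqrt (\sum_(i < d) (B i z.1 - B i z.2) ^+ 2)) pi)).
  apply/funext => z; rewrite sqr_cone_dist.
  have [->|r1] := eqVneq (cone_radius z.1) 0; first by rewrite !(mulr0, mul0r).
  have [->|r2] := eqVneq (cone_radius z.2) 0; first by rewrite !(mulr0, mul0r).
  congr (_ - _ * cos (Num.min (Num.sqrt _) _)); apply: eq_bigr => i _.
  by rewrite /B /off_vertex (negbTE r1) (negbTE r2).
have m1 : measurable_fun setT
    (fun z : borel_cone ne * borel_cone ne => cone_radius z.1).
  exact: (measurableT_comp measurable_cone_radius).
have m2 : measurable_fun setT
    (fun z : borel_cone ne * borel_cone ne => cone_radius z.2).
  exact: (measurableT_comp measurable_cone_radius).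
apply: measurable_funB.
  by apply: measurable_funD; exact: measurable_funX.
apply: measurable_funM; first by apply: measurable_funM => //; apply: measurable_funM.
apply: (measurableT_comp (continuous_measurable_fun (@continuous_cos R))).
apply: measurable_minr => //.
apply: (measurableT_comp (continuous_measurable_fun (@sqrt_continuous R))).
apply: measurable_sum => i; apply: measurable_funX.
have mB : measurable_fun setT (fun p : borel_cone ne => B i p).
  by apply: measurable_off_vertex; exact: continuous_base_coord.
by apply: measurable_funB; exact: (measurableT_comp mB).
Qed.

End ConeTopology.

(** * Measures on the cone that project to a point mass *)

Section PointMasses.
Context {R : realType} {d : nat} {Omega : set 'rV[R]_d} {ne : Omega !=set0}.
Implicit Types (a b : R) (x y : base_space ne) (lam : cone_measures ne).

(** The mass is [a ^+ 2], so that the unit Dirac mass at cone radius [a] over [x] is a lift. *)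
Definition point_mass a x : measures ne :=
  mscale (NngNum (sqr_ge0 a)) \d_(x : borel_base ne).

Definition cone_dirac a (a0 : 0 <= a) x : cone_measures ne :=
  \d_(cone_pt x (NngNum a0) : borel_cone ne).

Lemma integral_point_mass a x (phi : base_space ne -> R) : continuous phi ->
  (\int[point_mass a x]_y (phi y)%:E = (a ^+ 2 * phi x)%:E)%E.
Proof.
move=> cphi.
have mphi : measurable_fun setT (fun y : borel_base ne => (phi y)%:E).
  by apply/measurable_EFinP; exact: measurable_continuous_base.
rewrite /point_mass integralE !ge0_integral_mscale//; last 2 first.
  exact: measurable_funeneg.
  exact: measurable_funepos.
rewrite -muleBr//; last first.
  rewrite !integral_dirac//; last 2 first.
  - exact: measurable_funeneg.
  - exact: measurable_funepos.
  by rewrite diracT !mul1e funenegE -EFin_max fin_num_adde_defl.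
by rewrite -integralE integral_dirac// diracT mul1e -EFinM.
Qed.

Lemma cone_dirac_projects a (a0 : 0 <= a) x :
  projects_to (cone_dirac a0 x) (point_mass a x).
Proof.
move=> phi cphi; rewrite integral_point_mass// /cone_dirac integral_dirac//.
  rewrite diracT mul1e cone_radiusE/=; congr (_%:E).
  have [z|aN0] := boolP (a == 0).
    by rewrite [a ^+ 2](_ : _ = 0) ?(eqP z) ?expr0n// !mul0r.
  by rewrite cone_baseE.
by apply/measurable_EFinP; exact: measurable_sqr_radius_base.
Qed.

Lemma measurable_sqr_radius :
  measurable_fun setT (fun p : borel_cone ne => (cone_radius p ^+ 2)%:E).
Proof.
apply/measurable_EFinP; apply: measurable_funX; exact: measurable_cone_radius.
Qed.

Lemma cone_dirac_second_moment a (a0 : 0 <= a) x :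
  finite_second_moment (cone_dirac a0 x).
Proof.
rewrite /finite_second_moment /cone_dirac integral_dirac//.
  by rewrite diracT mul1e ltry.
exact: measurable_sqr_radius.
Qed.

(** Test the projection with the constant 1. *)
Lemma projects_to_second_moment lam a x : projects_to lam (point_mass a x) ->
  (\int[lam]_p (cone_radius p ^+ 2)%:E = (a ^+ 2)%:E)%E.
Proof.
have c1 : continuous (fun _ : base_space ne => 1 : R).
  exact: cst_continuous.
move=> /(_ _ c1); rewrite integral_point_mass// mulr1 => ->.
by apply: eq_integral => p _; rewrite mulr1.
Qed.

(** Test the projection with the distance to [x]: the nonnegative function
    [cone_radius p ^+ 2 * phi (cone_base p)] has integral zero, so it vanishes almost everywhere. *)
Lemma projects_to_ae_base lam a x : projects_to lam (point_mass a x) ->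
  {ae lam, forall p, cone_radius p = 0 \/ cone_base p = x}.
Proof.
pose phi y : R := `|\val y - \val x|.
have cphi : continuous phi.
  move=> y; apply: (@continuous_comp _ _ _ (fun y : base_space ne => \val y)
    (fun u : 'rV[R]_d => `|u - \val x|)); first exact: initial_continuous.
  apply: (@continuous_comp _ _ _ (fun u : 'rV[R]_d => u - \val x)).
    apply: (@continuousB _ _ _ id (cst (\val x))).
      exact: cvg_id.
    exact: cst_continuous.
  exact: norm_continuous.
move=> /(_ phi cphi); rewrite integral_point_mass// {1}/phi subrr normr0 mulr0.
move=> /esym I0.
have mF : measurable_fun setT
    (fun p : borel_cone ne => (cone_radius p ^+ 2 * phi (cone_base p))%:E).
  by apply/measurable_EFinP; exact: measurable_sqr_radius_base.
have /(ae_eq_integral_abs lam measurableT mF) : (\int[lam]_p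
    `|(cone_radius p ^+ 2 * phi (cone_base p))%:E| = 0)%E.
  rewrite -[RHS]I0; apply: eq_integral => p _ /=.
  by rewrite ger0_norm// mulr_ge0 ?sqr_ge0 /phi.
apply: filterS => p /(_ I) /= [] /eqP; rewrite mulf_eq0 sqrf_eq0.
case/orP => [/eqP|]; first by left.
by rewrite normr_eq0 subr_eq0 => /eqP /val_inj; right.
Qed.

End PointMasses.

(** * The Hellinger-Kantorovich distance of two point masses *)

Section HKPointMasses.
Context {R : realType} {d : nat} {Omega : set 'rV[R]_d} {ne : Omega !=set0}.
Implicit Types (a b : R) (x y : base_space ne) (lam : cone_measures ne).
Implicit Type gam : {measure set (borel_cone ne * borel_cone ne)%type -> \bar R}.

Lemma coupling_integral1 lam0 lam1 gam (f : borel_cone ne -> \bar R) :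
  coupling lam0 lam1 gam -> measurable_fun setT f -> (forall p, 0 <= f p)%E ->
  (\int[gam]_z f z.1 = \int[lam0]_p f p)%E.
Proof.
move=> cpl mf f0.
rewrite -(@ge0_integral_pushforward _ _ _ _ _ fst measurable_fst gam setT f)//.
apply: eq_measure_integral => A mA _; apply: etrans (cpl A mA).1.
congr (gam _).
by apply/seteqP; split => z /=; [|case].
Qed.

Lemma coupling_integral2 lam0 lam1 gam (f : borel_cone ne -> \bar R) :
  coupling lam0 lam1 gam -> measurable_fun setT f -> (forall p, 0 <= f p)%E ->
  (\int[gam]_z f z.2 = \int[lam1]_p f p)%E.
Proof.
move=> cpl mf f0.
rewrite -(@ge0_integral_pushforward _ _ _ _ _ snd measurable_snd gam setT f)//.
apply: eq_measure_integral => A mA _; apply: etrans (cpl A mA).2.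
congr (gam _).
by apply/seteqP; split => z /=; [|case].
Qed.

Lemma coupling_ae1 lam0 lam1 gam (P : borel_cone ne -> Prop) :
  coupling lam0 lam1 gam -> {ae lam0, forall p, P p} -> {ae gam, forall z, P z.1}.
Proof.
move=> cpl [N [mN N0 PN]]; exists (N `*` setT); split.
- exact: measurableX.
- by rewrite (cpl N mN).1.
- by move=> z nPz; split => //; exact: PN.
Qed.

Lemma coupling_ae2 lam0 lam1 gam (P : borel_cone ne -> Prop) :
  coupling lam0 lam1 gam -> {ae lam1, forall p, P p} -> {ae gam, forall z, P z.2}.
Proof.
move=> cpl [N [mN N0 PN]]; exists (setT `*` N); split.
- exact: measurableX.
- by rewrite (cpl N mN).2.
- by move=> z nPz; split => //; exact: PN.
Qed.

(** Almost everywhere the bases are [x] and [y], or a radius vanishes and with it the cross term; so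
    the cost is at least [g]. The second moments are [a ^+ 2] and [b ^+ 2], and a weighted form of
    Cauchy-Schwarz bounds the integral of [r1 * r2] by [a * b]. The lifts are arbitrary here, not
    only Dirac masses. *)
Lemma coupling_cost_ge lam0 lam1 gam a b x y (c : R) : 0 < a -> 0 < b ->
  projects_to lam0 (point_mass a x) -> projects_to lam1 (point_mass b y) ->
  coupling lam0 lam1 gam -> 0 <= c ->
  cos (Num.min (euclid_dist (\val x) (\val y)) pi) <= c -> c <= 1 ->
  ((a ^+ 2 + b ^+ 2 - 2 * a * b * c)%:E <=
    \int[gam]_z (cone_dist z.1 z.2 ^+ 2)%:E)%E.
Proof.
move=> a0 b0 Px Py cpl c0 cosc c1.
pose r1 (z : borel_cone ne * borel_cone ne) := cone_radius z.1.
pose r2 (z : borel_cone ne * borel_cone ne) := cone_radius z.2.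
have r1_ge0 z : 0 <= r1 z by exact: cone_radius_ge0.
have r2_ge0 z : 0 <= r2 z by exact: cone_radius_ge0.
have mr1 : measurable_fun setT r1.
  exact: (measurableT_comp measurable_cone_radius).
have mr2 : measurable_fun setT r2.
  exact: (measurableT_comp measurable_cone_radius).
have I1 : (\int[gam]_z (r1 z ^+ 2)%:E = (a ^+ 2)%:E)%E.
  rewrite -(projects_to_second_moment Px).
  apply: (coupling_integral1 (f := fun p => (cone_radius p ^+ 2)%:E) cpl).
    exact: measurable_sqr_radius.
  by move=> p; rewrite lee_fin sqr_ge0.
have I2 : (\int[gam]_z (r2 z ^+ 2)%:E = (b ^+ 2)%:E)%E.
  rewrite -(projects_to_second_moment Py).
  apply: (coupling_integral2 (f := fun p => (cone_radius p ^+ 2)%:E) cpl).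
    exact: measurable_sqr_radius.
  by move=> p; rewrite lee_fin sqr_ge0.
have mr1X : measurable_fun setT (fun z => (r1 z ^+ 2)%:E).
  by apply/measurable_EFinP; exact: measurable_funX.
have mr2X : measurable_fun setT (fun z => (r2 z ^+ 2)%:E).
  by apply/measurable_EFinP; exact: measurable_funX.
pose g z := r1 z ^+ 2 + r2 z ^+ 2 - 2 * r1 z * r2 z * c.
have g_ge0 z : 0 <= g z.
  by rewrite (le_trans _ (cone_cos_law_ge _ _ c1)) ?sqr_ge0.
have mg : measurable_fun setT g.
  apply: measurable_funB.
    by apply: measurable_funD; exact: measurable_funX.
  apply: measurable_funM => //; apply: measurable_funM => //.
  exact: measurable_funM.
have mgE : measurable_fun setT (fun z => (g z)%:E) by exact/measurable_EFinP.
have gle : (\int[gam]_z (g z)%:E <= \int[gam]_z (cone_dist z.1 z.2 ^+ 2)%:E)%E.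
  apply: ae_ge0_le_integral => //.
  - by move=> z _; rewrite lee_fin.
  - by move=> z _; rewrite lee_fin sqr_ge0.
  - by apply/measurable_EFinP; exact: measurable_sqr_cone_dist.
  apply: filterS2 (coupling_ae1 cpl (projects_to_ae_base Px))
    (coupling_ae2 cpl (projects_to_ae_base Py)) => z b1 b2 _.
  rewrite lee_fin sqr_cone_dist /g -/(r1 z) -/(r2 z).
  case: b1 => [r0|->]; first by rewrite /r1 r0 !(mulr0, mul0r).
  case: b2 => [r0|->]; first by rewrite /r2 r0 !(mulr0, mul0r).
  by rewrite lerD2l lerN2 ler_wpM2l// !mulr_ge0.
apply: le_trans gle.
have k1_ge0 : 0 <= c * (b / a) by rewrite mulr_ge0// divr_ge0// ltW.
have k2_ge0 : 0 <= c * (a / b) by rewrite mulr_ge0// divr_ge0// ltW.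
(* The inequality is arranged without subtraction, so that all integrands are nonnegative and the
   integral splits; the finite terms move across afterwards. *)
have : (\int[gam]_z ((r1 z ^+ 2)%:E + (r2 z ^+ 2)%:E) <= \int[gam]_z ((g z)%:E +
   ((c * (b / a))%:E * (r1 z ^+ 2)%:E + (c * (a / b))%:E * (r2 z ^+ 2)%:E)))%E.
  apply: ge0_le_integral => //.
  - by move=> z _; rewrite adde_ge0// lee_fin sqr_ge0.
  - exact: emeasurable_funD.
  - apply: emeasurable_funD => //; apply: emeasurable_funD;
    exact: measurable_funeM.
  move=> z _; rewrite -!EFinM -!EFinD lee_fin /g.
  (* 2 r1 r2 <= (b / a) r1^2 + (a / b) r2^2 *)
  have : 0 <= c * (b / a * (r1 z - a / b * r2 z) ^+ 2).
    by apply: mulr_ge0 => //; apply: mulr_ge0; rewrite ?sqr_ge0// ltW// divr_gt0.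
  have -> : b / a * (r1 z - a / b * r2 z) ^+ 2
    = b / a * r1 z ^+ 2 + a / b * r2 z ^+ 2 - 2 * r1 z * r2 z.
    by field; rewrite !gt_eqF.
  by lra.
rewrite ge0_integralD//; last 2 first.
- by move=> z _; rewrite lee_fin sqr_ge0.
- by move=> z _; rewrite lee_fin sqr_ge0.
rewrite I1 I2 ge0_integralD//; last 3 first.
- by move=> z _; rewrite lee_fin.
- by move=> z _; rewrite adde_ge0// mule_ge0// lee_fin// sqr_ge0.
- by apply: emeasurable_funD; exact: measurable_funeM.
rewrite ge0_integralD//; last 4 first.
- by move=> z _; rewrite mule_ge0// lee_fin// sqr_ge0.
- exact: measurable_funeM.
- by move=> z _; rewrite mule_ge0// lee_fin// sqr_ge0.
- exact: measurable_funeM.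
rewrite !ge0_integralZl_EFin//; last 2 first.
- by move=> z _; rewrite lee_fin sqr_ge0.
- by move=> z _; rewrite lee_fin sqr_ge0.
rewrite I1 I2 -!EFinM -!EFinD -leeBlDr// -EFinB.
apply: le_trans; rewrite lee_fin le_eqVlt; apply/orP; left; apply/eqP.
by field; rewrite !gt_eqF.
Qed.

(** The lower bound is [coupling_cost_ge] with the cosine itself as [c], nonnegative because the
    angle is at most [pi / 2]. The upper bound comes from Dirac lifts and the Dirac coupling of
    them. *)
Lemma HK_point_mass a b x y : 0 < a -> 0 < b ->
  euclid_dist (\val x) (\val y) <= pi / 2 ->
  HK (point_mass a x) (point_mass b y) =
  (Num.sqrt (a ^+ 2 + b ^+ 2
     - 2 * a * b * cos (euclid_dist (\val x) (\val y))))%:E.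
Proof.
move=> a0 b0 xy; set c := cos _.
have minE : Num.min (euclid_dist (\val x) (\val y)) pi
    = euclid_dist (\val x) (\val y).
  by apply/min_idPl; rewrite (le_trans xy)// ler_pdivrMr// ler_peMr ?pi_ge0// ler1n.
have c_ge0 : 0 <= c.
  by rewrite cos_ge0_pihalf// xy andbT (le_trans _ (euclid_dist_ge0 _ _))//
    oppr_le0 divr_ge0// pi_ge0.
have -> : (Num.sqrt (a ^+ 2 + b ^+ 2 - 2 * a * b * c))%:E
  = sqrte (a ^+ 2 + b ^+ 2 - 2 * a * b * c)%:E by [].
have D_ge0 : 0 <= a ^+ 2 + b ^+ 2 - 2 * a * b * c.
  by rewrite (le_trans _ (cone_cos_law_ge (ltW a0) (ltW b0) (cos_le1 _)))// sqr_ge0.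
apply/eqP; rewrite eq_le; apply/andP; split; last first.
  apply/ereal_infP => _ [lam0 [lam1 [_ _ Px Py ->]]].
  rewrite /cone_wasserstein lee_sqrt; last first.
    apply/ereal_infP => _ [gam _ ->]; apply: integral_ge0 => z _.
    by rewrite lee_fin sqr_ge0.
  apply/ereal_infP => _ [gam cpl ->].
  by apply: coupling_cost_ge Px Py cpl _ _ _; rewrite ?minE// cos_le1.
pose lam0 := cone_dirac (ltW a0) x; pose lam1 := cone_dirac (ltW b0) y.
apply: (@le_trans _ _ (cone_wasserstein lam0 lam1)).
  apply: ereal_inf_lbound; exists lam0, lam1.
  by split => //; [exact: cone_dirac_second_moment|
    exact: cone_dirac_second_moment|exact: cone_dirac_projects|
    exact: cone_dirac_projects].
rewrite lee_sqrt ?lee_fin//.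
apply: ereal_inf_lbound.
pose p : borel_cone ne := cone_pt x (NngNum (ltW a0)).
pose q : borel_cone ne := cone_pt y (NngNum (ltW b0)).
exists (\d_(p, q)).
  move=> A mA.
  have e1 : ((p, q) \in A `*` setT) = (p \in A).
    by apply/idP/idP; rewrite !inE; [case|].
  have e2 : ((p, q) \in setT `*` A) = (q \in A).
    by apply/idP/idP; rewrite !inE; [case|].
  pose ind (h : bool) := (h%:R : R)%:E.
  by split; [exact: (congr1 ind e1)|exact: (congr1 ind e2)].
rewrite integral_dirac//; last first.
  by apply/measurable_EFinP; exact: measurable_sqr_cone_dist.
rewrite diracT mul1e sqr_cone_dist/= !cone_radiusE/= !cone_baseE/= ?gt_eqF//.
by rewrite minE.
Qed.

End HKPointMasses.

(** * Planar charts of convex sets *)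

Section PlanarChart.
Context {R : realType} {d : nat}.
Implicit Types (u v w p q : 'rV[R]_d) (A : set 'rV[R]_d).

Definition dot u v : R := \sum_(i < d) u ord0 i * v ord0 i.

Lemma dotC u v : dot u v = dot v u.
Proof. by apply: eq_bigr => i _; rewrite mulrC. Qed.

Lemma dotDl u v w : dot (u + v) w = dot u w + dot v w.
Proof. by rewrite -big_split; apply: eq_bigr => i _; rewrite mxE mulrDl. Qed.

Lemma dotZl (a : R) u v : dot (a *: u) v = a * dot u v.
Proof. by rewrite mulr_sumr; apply: eq_bigr => i _; rewrite mxE mulrA. Qed.

Lemma dotDr u v w : dot w (u + v) = dot w u + dot w v.
Proof. by rewrite !(dotC w) dotDl. Qed.

Lemma dotZr (a : R) u v : dot u (a *: v) = a * dot u v.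
Proof. by rewrite !(dotC u) dotZl. Qed.

Lemma dot_gt0 u : u != 0 -> 0 < dot u u.
Proof.
move=> u0; have nn i : 0 <= u ord0 i * u ord0 i by rewrite -expr2 sqr_ge0.
rewrite lt_def sumr_ge0// andbT; apply: contra u0 => /eqP.
move/psumr_eq0P => z; apply/eqP/rowP => i; rewrite mxE.
by apply/eqP; rewrite -[_ == 0]orbb -mulf_eq0 z.
Qed.

Lemma euclid_distE u v : euclid_dist u v = Num.sqrt (dot (u - v) (u - v)).
Proof.
by congr Num.sqrt; apply: eq_bigr => i _; rewrite !mxE expr2.
Qed.

(** Otherwise the affine hull would lie in the line through [p] along [u], and [U], whose vectors
    are differences of hull points, in the span of [u]. With [u = 0] this yields a point other than
    [p]. *)
Lemma has_dimension_not_line A n p u : has_dimension A n -> (2 <= n)%N ->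
  exists2 w, A w & w - p \notin <[u]>%VS.
Proof.
move=> [x [U [hA dimU]]] n2; apply: contrapT => nex.
have line w : A w -> w - p \in <[u]>%VS.
  by move=> Aw; apply: contrapT => /negP wp; apply: nex; exists w.
have hull y : affine_hull A y -> y - p \in <[u]>%VS.
  move=> [k [z [c [Az c1 ->]]]].
  rewrite -[p]scale1r -c1 scaler_suml -sumrB memv_suml// => i _.
  by rewrite -scalerBr memvZ// line.
have hullU v : v \in U -> x + v - p \in <[u]>%VS.
  by move=> vU; apply: hull; rewrite hA; exists v.
have /dimvS : (U <= <[u]>)%VS.
  apply/subvP => v vU; rewrite (_ : v = (x + v - p) - (x + 0 - p)).
    by rewrite memvB ?hullU ?mem0v.
  by apply/rowP => i; rewrite !mxE; ring.
by rewrite dimU dim_vline; case: (u != 0); case: n n2 {dimU} => [|[|]].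
Qed.

Lemma convex_set_comb A p q (l : R) : convex_set A -> A p -> A q ->
  0 <= l <= 1 -> A (l *: p + (1 - l) *: q).
Proof.
move=> cA Ap Aq /andP[l0 l1].
by have := cA p q (Itv01 l0 l1) (mem_set Ap) (mem_set Aq); rewrite inE.
Qed.

(** The weights of [p], [q], [w] are [1 - b - c], [b], [c]. First mix [q] and [p] in the ratio
    [b / (1 - c)], then mix in [w]. *)
Lemma convex_set_comb3 A p q w (b c : R) : convex_set A -> A p -> A q -> A w ->
  0 <= b -> 0 <= c -> c < 1 -> b + c <= 1 ->
  A (p + b *: (q - p) + c *: (w - p)).
Proof.
move=> cA Ap Aq Aw b0 c0 c1 bc.
have c1' : 0 < 1 - c by rewrite subr_gt0.
have Apq : A (b / (1 - c) *: q + (1 - b / (1 - c)) *: p).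
  apply: convex_set_comb => //.
  by rewrite divr_ge0 ?(ltW c1')//= ler_pdivrMr// mul1r lerBrDr.
have := convex_set_comb cA Aw Apq (l := c); rewrite c0 (ltW c1) => /(_ isT).
congr (A _); apply/rowP => i; rewrite !mxE; field.
by rewrite gt_eqF.
Qed.

(** Take a nondegenerate triangle in [A], apply Gram-Schmidt to two of its edges, and fit a small
    square around its barycentre. *)
Lemma convex_planar_chart A n : convex_set A -> has_dimension A n ->
  (2 <= n)%N -> exists (m e1 e2 : 'rV[R]_d) (t : R),
  [/\ 0 < t,
      forall a b, `|a| <= t -> `|b| <= t -> A (m + a *: e1 + b *: e2) &
      forall a b a' b',
        euclid_dist (m + a *: e1 + b *: e2) (m + a' *: e1 + b' *: e2)
        = Num.sqrt ((a - a') ^+ 2 + (b - b') ^+ 2)].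
Proof.
move=> cA dimA n2.
have [p Ap] := has_dimension_nonempty dimA.
have [q Aq qp] := has_dimension_not_line p 0 dimA n2.
have [w Aw wp] := has_dimension_not_line p (q - p) dimA n2.
set u := q - p in qp wp *; set v := w - p in wp *.
have u0 : u != 0 by apply: contra qp => /eqP ->; rewrite mem0v.
have uu := dot_gt0 u0.
pose k := dot v u / dot u u; pose v' := v - k *: u.
have v'0 : v' != 0.
  by apply: contra wp; rewrite subr_eq0 => /eqP ->; rewrite memvZ// memv_line.
have vv := dot_gt0 v'0.
have uv' : dot u v' = 0.
  rewrite /v' -scaleNr dotDr dotZr /k (dotC v); field.
  by rewrite gt_eqF.
pose nu := Num.sqrt (dot u u); pose nv := Num.sqrt (dot v' v').
have nu0 : 0 < nu by rewrite sqrtr_gt0.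
have nv0 : 0 < nv by rewrite sqrtr_gt0.
have nuE : nu ^+ 2 = dot u u by rewrite sqr_sqrtr// ltW.
have nvE : nv ^+ 2 = dot v' v' by rewrite sqr_sqrtr// ltW.
pose e1 := nu^-1 *: u; pose e2 := nv^-1 *: v'.
have e11 : dot e1 e1 = 1.
  by rewrite dotZl dotZr -nuE; field; rewrite gt_eqF.
have e22 : dot e2 e2 = 1.
  by rewrite dotZl dotZr -nvE; field; rewrite gt_eqF.
have e12 : dot e1 e2 = 0 by rewrite dotZl dotZr uv' !mulr0.
(* For [|a|] and [|b|] at most [t], the barycentric coordinates change by at most [t * S] in
   total. *)
pose S := nu^-1 + (`|k| + 1) / nv.
have S0 : 0 < S.
  by rewrite ltr_wpDr ?invr_gt0// divr_ge0 ?(ltW nv0)// addr_ge0.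
(* The centre is the barycentre. With [t * S = 1/6] the weights of [q] and [w] stay at least 1/6 and
   their sum at most 5/6. *)
exists (p + 3^-1 *: u + 3^-1 *: v), e1, e2, (6 * S)^-1; split.
- by rewrite invr_gt0 mulr_gt0.
- move=> a b at0 bt0.
  pose a' := a / nu - b * k / nv; pose b' := b / nv.
  have -> : p + 3^-1 *: u + 3^-1 *: v + a *: e1 + b *: e2
      = p + (3^-1 + a') *: u + (3^-1 + b') *: v.
    apply/rowP => i; rewrite /e1 /e2 /v' /a' /b' !mxE; field.
    by rewrite !gt_eqF.
  have tS : (6 * S)^-1 * S = 6^-1.
    by field; rewrite gt_eqF.
  have : `|a| / nu + `|b| * `|k| / nv + `|b| / nv <= 6^-1.
    have x0 : 0 <= nu^-1 by rewrite invr_ge0 ltW.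
    have y0 : 0 <= nv^-1 by rewrite invr_ge0 ltW.
    have g1 := ler_wpM2r x0 at0.
    have g2 := ler_wpM2r (mulr_ge0 (normr_ge0 k) y0) bt0.
    have g3 := ler_wpM2r y0 bt0.
    rewrite -tS; set T := (6 * S)^-1 in g1 g2 g3 *; rewrite /S; lra.
  have h1 : `|a'| <= `|a| / nu + `|b| * `|k| / nv.
    rewrite (le_trans (ler_normB _ _))// !normrM !normfV.
    by rewrite (gtr0_norm nu0) (gtr0_norm nv0).
  have h2 : `|b'| = `|b| / nv by rewrite normrM normfV (gtr0_norm nv0).
  have h3 : 0 <= `|b| / nv by rewrite divr_ge0// ltW.
  have h4 : 0 <= `|a'| by [].
  rewrite -h2 in h3 * => h5.
  have [/ler_normlP[a1 a2] /ler_normlP[b1 b2]] :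
    `|a'| <= 6^-1 /\ `|b'| <= 6^-1 by split; lra.
  by apply: convex_set_comb3 => //; lra.
clearbody e1 e2 => a b a' b'; rewrite euclid_distE.
have -> : p + 3^-1 *: u + 3^-1 *: v + a *: e1 + b *: e2 -
   (p + 3^-1 *: u + 3^-1 *: v + a' *: e1 + b' *: e2)
   = (a - a') *: e1 + (b - b') *: e2.
  by apply/rowP => i; rewrite !mxE; ring.
congr Num.sqrt; rewrite !(dotDl, dotDr, dotZl, dotZr) e11 e22 (dotC e2) e12.
by ring.
Qed.

End PlanarChart.

(** * Trigonometry of the 3-4-5 triangle and of the geodesic *)

(* 2 cos 3t cos 4t = cos t + cos 7t, so the difference is a polynomial in cos t, and
   it vanishes to fourth order at t = 0 *)
Lemma cos_pythagorean_triple {R : realType} (t : R) :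
  cos (3 * t) * cos (4 * t) - cos (5 * t)
  = 8 * cos t * (1 - cos t ^+ 2) ^+ 2 * (4 * cos t ^+ 2 - 1).
Proof.
have c2 : cos (2 * t) = 2 * cos t ^+ 2 - 1.
  by rewrite mulr_natl cos_mulr2n; ring.
have s2 : sin (2 * t) = 2 * sin t * cos t.
  by rewrite mulr_natl sin_mulr2n; ring.
have c4 : cos (4 * t) = 2 * cos (2 * t) ^+ 2 - 1.
  by rewrite (_ : 4 * t = (2 * t) *+ 2) ?cos_mulr2n; ring.
have s4 : sin (4 * t) = 2 * sin (2 * t) * cos (2 * t).
  by rewrite (_ : 4 * t = (2 * t) *+ 2) ?sin_mulr2n; ring.
have -> : cos (3 * t) = cos (2 * t) * cos t - sin (2 * t) * sin t.
  by rewrite -cosD; congr cos; ring.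
have -> : cos (5 * t) = cos (4 * t) * cos t - sin (4 * t) * sin t.
  by rewrite -cosD; congr cos; ring.
rewrite c4 s4 c2 s2; have := sin2cos2 t; set c := cos t; set s := sin t => E.
have -> : 2 * (2 * s * c) * (2 * c ^+ 2 - 1) * s
  = 4 * s ^+ 2 * c * (2 * c ^+ 2 - 1) by ring.
have -> : 2 * s * c * s = 2 * s ^+ 2 * c by ring.
by rewrite E; ring.
Qed.

(** All factors of the polynomial are positive: [1 - cos t ^+ 2] is [sin t ^+ 2], and
    [4 * cos t ^+ 2 - 1] is [2 * cos (2 * t) + 1]. *)
Lemma cos_pythagorean_triple_gt {R : realType} (t : R) : 0 < t -> 6 * t <= 1 ->
  cos (5 * t) < cos (3 * t) * cos (4 * t).
Proof.
move=> t0 t1; have pi2 := @pihalf_ge1 R.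
rewrite -subr_gt0 cos_pythagorean_triple.
have c0 : 0 < cos t by apply: cos_gt0_pihalf; apply/andP; split; lra.
have s0 : 0 < sin t by apply: sin_gt0_pihalf; apply/andP; split; lra.
have c30 : 0 < cos (2 * t) by apply: cos_gt0_pihalf; apply/andP; split; lra.
rewrite mulr_gt0//.
  by rewrite -sin2cos2 mulr_gt0 ?exprn_gt0// mulr_gt0.
by move: c30; rewrite mulr_natl cos_mulr2n; lra.
Qed.

Section RadialCurve.
Context {R : realType} (t : R) (t_gt0 : 0 < t) (t_le : 6 * t <= 1).

(* In the cone over the segment, a flat sector, the geodesic from angle -3t to
   angle 3t on the unit circle is a straight chord; its point at time s has
   Cartesian coordinates (cos 3t, (2s - 1) sin 3t). *)
Definition chord_slope (s : R) := (2 * s - 1) * tan (3 * t).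
Definition chord_angle s := atan (chord_slope s).
Definition chord_radius s := cos (3 * t) * Num.sqrt (1 + chord_slope s ^+ 2).

Let t3_itv : 3 * t \in `](- (pi / 2)), (pi / 2)[.
Proof.
have p1 := @pihalf_ge1 R; move: t_gt0 t_le => h1 h2.
by rewrite in_itv/=; apply/andP; split; lra.
Qed.

Let cos3_gt0 : 0 < cos (3 * t).
Proof. by have := t3_itv; rewrite in_itv/=; exact: cos_gt0_pihalf. Qed.

Let tan3_gt0 : 0 < tan (3 * t).
Proof.
have := t3_itv; rewrite in_itv/= => /andP[_ t3].
by rewrite /tan divr_gt0// sin_gt0_pihalf// t3 mulr_gt0.
Qed.

Let sqrt_slope_gt0 s : 0 < Num.sqrt (1 + chord_slope s ^+ 2).
Proof. by rewrite sqrtr_gt0 ltr_wpDr// sqr_ge0. Qed.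

Lemma chord_radius_gt0 s : 0 < chord_radius s.
Proof. exact: mulr_gt0. Qed.

Lemma sqr_chord_radius s :
  chord_radius s ^+ 2 = cos (3 * t) ^+ 2 + ((2 * s - 1) * sin (3 * t)) ^+ 2.
Proof.
rewrite /chord_radius exprMn sqr_sqrtr ?addr_ge0 ?sqr_ge0// /chord_slope /tan.
by field; rewrite gt_eqF.
Qed.

Lemma chord_radius_cos s : chord_radius s * cos (chord_angle s) = cos (3 * t).
Proof. by rewrite /chord_radius cos_atan mulfK// gt_eqF. Qed.

Lemma chord_radius_sin s :
  chord_radius s * sin (chord_angle s) = (2 * s - 1) * sin (3 * t).
Proof.
have ca : cos (chord_angle s) != 0.
  by rewrite cos_atan invr_neq0// gt_eqF.
have -> : sin (chord_angle s) = chord_slope s * cos (chord_angle s).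
  by rewrite -[chord_slope s]atanK /tan -/(chord_angle s) divfK.
rewrite mulrCA chord_radius_cos /chord_slope /tan.
by field; rewrite gt_eqF.
Qed.

(** [atan] is increasing and the slope stays between [- tan (3 * t)] and [tan (3 * t)]. *)
Lemma chord_angle_bound s : 0 <= s <= 1 -> `|chord_angle s| <= 3 * t.
Proof.
move=> /andP[s0 s1]; have E : 3 * t = atan (tan (3 * t)) by rewrite tanK.
have mono (x y : R) : x <= y -> atan x <= atan y.
  by rewrite le_eqVlt => /predU1P[->//|/lt_atan/ltW].
have h1 : (1 - s) * tan (3 * t) >= 0 by rewrite mulr_ge0 ?subr_ge0// ltW.
have h2 : s * tan (3 * t) >= 0 by rewrite mulr_ge0// ltW.
rewrite ler_norml; apply/andP; split; rewrite {1}E -?atanN;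
  by apply: mono; rewrite /chord_slope; lra.
Qed.

Lemma chord_angle0 : chord_angle 0 = - (3 * t).
Proof.
by rewrite /chord_angle /chord_slope mulr0 sub0r mulN1r atanN tanK.
Qed.

Lemma chord_angle1 : chord_angle 1 = 3 * t.
Proof.
rewrite /chord_angle /chord_slope (_ : 2 * 1 - 1 = 1); last by ring.
by rewrite mul1r tanK.
Qed.

Lemma chord_half : chord_angle 2^-1 = 0 /\ chord_radius 2^-1 = cos (3 * t).
Proof.
have u0 : chord_slope 2^-1 = 0 by rewrite /chord_slope mulfV ?subrr ?mul0r.
by rewrite /chord_angle /chord_radius u0 atan0 expr0n addr0 sqrtr1 mulr1.
Qed.

Lemma chord_radius_ends : chord_radius 0 = 1 /\ chord_radius 1 = 1.
Proof.
have r0 s : chord_radius s ^+ 2 = 1 -> chord_radius s = 1.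
  move=> E; apply/eqP; have /eqP := E.
  rewrite sqrf_eq1 => /orP[//|/eqP h].
  by have := chord_radius_gt0 s; rewrite h; lra.
split; apply: r0; rewrite sqr_chord_radius -[RHS](cos2Dsin2 (3 * t)); ring.
Qed.

(** By the cosine law the left side is a squared planar distance between two points of a chord of
    length [2 * sin (3 * t)], traversed at constant speed. *)
Lemma chord_dist s s' : chord_radius s ^+ 2 + chord_radius s' ^+ 2
  - 2 * chord_radius s * chord_radius s' * cos (chord_angle s - chord_angle s')
  = ((s - s') * (2 * sin (3 * t))) ^+ 2.
Proof.
rewrite cosB !sqr_chord_radius.
have -> : 2 * chord_radius s * chord_radius s' *
  (cos (chord_angle s) * cos (chord_angle s') +
   sin (chord_angle s) * sin (chord_angle s')) =
  2 * ((chord_radius s * cos (chord_angle s))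
        * (chord_radius s' * cos (chord_angle s'))
    + (chord_radius s * sin (chord_angle s))
        * (chord_radius s' * sin (chord_angle s'))).
  by ring.
by rewrite !chord_radius_cos !chord_radius_sin; ring.
Qed.

End RadialCurve.

(** * The counterexample to semiconcavity *)

Lemma HK_sqr_point_mass {R : realType} {d : nat} {Omega : set 'rV[R]_d}
    {ne : Omega !=set0} (a b : R) (x y : base_space ne) : 0 < a -> 0 < b ->
  euclid_dist (\val x) (\val y) <= pi / 2 ->
  (HK (point_mass a x) (point_mass b y) ^+ 2 =
  (a ^+ 2 + b ^+ 2 - 2 * a * b * cos (euclid_dist (\val x) (\val y)))%:E)%E.
Proof.
move=> a0 b0 xy; rewrite HK_point_mass// -EFin_expe sqr_sqrtr//.
by rewrite (le_trans _ (cone_cos_law_ge (ltW a0) (ltW b0) (cos_le1 _)))// sqr_ge0.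
Qed.

(** Total, with the distinguished point as default off [Omega], so that the curve of measures is
    defined for every real parameter. *)
Definition to_base {R : realType} {d : nat} {Omega : set 'rV[R]_d}
    (ne : Omega !=set0) (u : 'rV[R]_d) : base_space ne :=
  if pselect (Omega u) is left h
  then exist (fun v => v \in Omega) u (mem_set h) else point.

Lemma val_to_base {R : realType} {d : nat} {Omega : set 'rV[R]_d}
    (ne : Omega !=set0) (u : 'rV[R]_d) : Omega u -> \val (to_base ne u) = u.
Proof. by move=> Ou; rewrite /to_base; case: pselect. Qed.

Unset Implicit Arguments.

Theorem mainTheorem12 (R : realType) (d n : nat) (Omega : set 'rV[R]_d)
    (Omega_convex : convex_set Omega) (Omega_compact : compact Omega)
    (Omega_dim : has_dimension Omega n) (n_ge2 : (2 <= n)%N) (K : R) :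
  let ne := has_dimension_nonempty Omega_dim in
  exists (mu0 mu1 mustar : measures ne) (mu : R -> measures ne) (s : R),
    [/\ HK_geodesic mu, mu 0 = mu0, mu 1 = mu1, 0 <= s <= 1 &
      (HK (mu s) mustar ^+ 2 <
         (1 - s)%:E * HK mu0 mustar ^+ 2 + s%:E * HK mu1 mustar ^+ 2
         - (K * s * (1 - s))%:E * HK mu0 mu1 ^+ 2)%E].
Proof.
move=> ne.
have [m [e1 [e2 [t0 [t0_gt0 chart dist]]]]] :=
  convex_planar_chart Omega_convex Omega_dim n_ge2.
(* The bound 1/6 keeps all angles, at most [6 * t], below [pi / 2]; the bound [t0 / 4] keeps the
   coordinates [3 * t] and [4 * t] inside the chart. *)
pose t := Num.min 6^-1 (t0 / 4).
have t_gt0 : 0 < t by rewrite lt_min invr_gt0 divr_gt0// ltr0n.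
have t_6 : 6 * t <= 1 by have : t <= 6^-1 by [rewrite ge_min lexx]; lra.
have t_t0 : 4 * t <= t0.
  by have : t <= t0 / 4 by [rewrite ge_min lexx orbT]; lra.
have p1 := @pihalf_ge1 R.
pose P a b := to_base ne (m + a *: e1 + b *: e2).
have PE a b : `|a| <= t0 -> `|b| <= t0 -> \val (P a b) = m + a *: e1 + b *: e2.
  by move=> at0 bt0; rewrite val_to_base//; exact: chart.
pose th := chord_angle t; pose r := chord_radius t.
have th_le s : 0 <= s <= 1 -> `|th s| <= 3 * t.
  exact: (chord_angle_bound t_gt0 t_6).
have th_t0 s : 0 <= s <= 1 -> `|th s| <= t0 by move/th_le => h; lra.
have r_gt0 s : 0 < r s by exact: (chord_radius_gt0 t_gt0 t_6).
pose mu s : measures ne := point_mass (r s) (P (th s) 0).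
have z_t0 : `|0 : R| <= t0 by rewrite normr0 ltW.
have dist_mu s s' : 0 <= s <= 1 -> 0 <= s' <= 1 ->
    euclid_dist (\val (P (th s) 0)) (\val (P (th s') 0)) = `|th s - th s'|.
  move=> s01 s'01; rewrite !PE ?th_t0// dist subrr expr0n addr0.
  by rewrite sqrtr_sqr.
have HKmu s s' : 0 <= s <= 1 -> 0 <= s' <= 1 ->
    HK (mu s) (mu s') = (`|s - s'| * (2 * sin (3 * t)))%:E.
  move=> s01 s'01; rewrite HK_point_mass//; rewrite dist_mu//.
    rewrite cos_norm (chord_dist t_gt0 t_6) sqrtr_sqr normrM.
    rewrite [`|2 * _|]ger0_norm// mulr_ge0// sin_ge0_pi//.
    by apply/andP; split; lra.
  rewrite (le_trans (ler_normB _ _))//.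
  by have := th_le _ s01; have := th_le _ s'01; lra.
have i0 : 0 <= (0 : R) <= 1 by rewrite lexx ler01.
have i1 : 0 <= (1 : R) <= 1 by rewrite lexx ler01.
have ih : 0 <= (2^-1 : R) <= 1 by apply/andP; split; lra.
pose delta := cos (3 * t) * cos (4 * t) - cos (5 * t).
have delta_gt0 : 0 < delta by rewrite subr_gt0 cos_pythagorean_triple_gt.
(* This makes [M * delta] equal to [|K| + 1]. *)
pose M := (`|K| + 1) / delta.
have M_gt0 : 0 < M by rewrite divr_gt0// ltr_wpDl.
(* [D] is the distance to the base point of the target mass: [4 * t] from the midpoint, and [5 * t]
   from both ends by the 3-4-5 triangle. *)
have HKstar s D : 0 <= s <= 1 -> th s ^+ 2 + (4 * t) ^+ 2 = D ^+ 2 ->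
    0 <= D <= 5 * t -> (HK (mu s) (point_mass M (P 0%R (4 * t)%R)) ^+ 2 =
      (r s ^+ 2 + M ^+ 2 - 2 * r s * M * cos D)%:E)%E.
  move=> s01 DE /andP[D0 D5].
  have dE : euclid_dist (\val (P (th s) 0)) (\val (P 0 (4 * t))) = D.
    rewrite !PE ?th_t0//; last by rewrite ger0_norm// mulr_ge0// ltW.
    by rewrite dist subr0 sub0r sqrrN DE sqrtr_sqr ger0_norm.
  by rewrite HK_sqr_point_mass// dE//; lra.
exists (mu 0), (mu 1), (point_mass M (P 0 (4 * t))), mu, 2^-1; split => //.
  by move=> s s' s01 s'01; rewrite !HKmu// -EFinM sub0r normrN1 mul1r.
have [th_h r_h] := chord_half t; have [r_0 r_1] := chord_radius_ends t_gt0 t_6.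
rewrite (HKstar _ (4 * t))//; last 2 first.
- by rewrite /th th_h expr0n add0r.
- by apply/andP; split; lra.
rewrite (HKstar _ (5 * t))//; last 2 first.
- by rewrite /th (chord_angle0 t_gt0 t_6); ring.
- by apply/andP; split; lra.
rewrite (HKstar _ (5 * t))//; last 2 first.
- by rewrite /th (chord_angle1 t_gt0 t_6); ring.
- by apply/andP; split; lra.
rewrite HKmu// -EFin_expe -!EFinM -!EFinD lte_fin sub0r normrN1 mul1r.
rewrite /r r_h r_0 r_1.
have MdE : M * (cos (3 * t) * cos (4 * t) - cos (5 * t)) = `|K| + 1.
  by rewrite -/delta divfK// gt_eqF.
clearbody M.
(* The terms [M ^+ 2] cancel, and what remains is [K * sin (3 * t) ^+ 2 < sin (3 * t) ^+ 2 + 2 *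
   (|K| + 1)]. *)
rewrite exprMn sin2cos2.
have c2_ge0 : 0 <= cos (3 * t) ^+ 2 by exact: sqr_ge0.
have s2_ge0 : 0 <= 1 - cos (3 * t) ^+ 2 by rewrite -sin2cos2 sqr_ge0.
have k1 : K * (1 - cos (3 * t) ^+ 2) <= `|K| * (1 - cos (3 * t) ^+ 2).
  by rewrite ler_wpM2r// ler_norm.
have K_ge0 := normr_ge0 K.
have k2 : 0 <= `|K| * cos (3 * t) ^+ 2 by rewrite mulr_ge0.
by lra.
Qed.
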